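(* (1) Let $\mathscr{A}=(a_{i_1i_2i_3i_4})\in\mathbb{T}_{4,2}$, where $a_{1122}=a_{2222}=1$, $a_{2112}=-1$ and all other $a_{i_1i_2i_3i_4}=0$. Then $\mathscr{A}$ is a $P_0$-tensor and a $Q$-tensor, but it is not an $R_0$-tensor. (2) Let $\mathscr{B}=(b_{i_1i_2i_3})\in\mathbb{T}_{3,2}$, where $b_{122}=b_{222}=1$, $b_{212}=-1$ and all other $b_{i_1i_2i_3}=0$. Then $\mathscr{B}$ is a $P_0^\prime$-tensor and a $Q$-tensor, but it is not an $R_0$-tensor. Consequently, the following assertion does not hold: if $\mathscr{A}\in\mathbb{T}_{m,n}$ is a $P_0$-tensor (or $\mathscr{A}\in\mathbb{T}_{m,n}$ is a $P_0^\prime$-tensor), then $$\mathscr{A}\in R_0\;\Longleftrightarrow\;\mathscr{A}\in R\;\Longleftrightarrow\;\mathscr{A}\in Q.$$ That is, these equivalences can be obtained neither under the assumption that $\mathscr{A}$ is a $P_0$-tensor nor under the assumption that $\mathscr{A}$ is a $P_0^\prime$-tensor.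
   Context: $m\ge 3$ and $n\ge 2$ are integers, $[n]=\{1,\ldots,n\}$, $\mathbb{R}^n_+=\{x\in\mathbb{R}^n:x\ge 0\}$ (componentwise). $\mathbb{T}_{m,n}$ is the set of real $m$-order $n$-dimensional tensors $\mathscr{A}=(a_{i_1\cdots i_m})$, $a_{i_1\cdots i_m}\in\mathbb{R}$ for $i_1,\ldots,i_m\in[n]$ (no symmetry assumed). For $x\in\mathbb{R}^n$, $\mathscr{A}x^{m-1}\in\mathbb{R}^n$ is defined by $(\mathscr{A}x^{m-1})_i=\sum_{i_2,\ldots,i_m=1}^n a_{ii_2\cdots i_m}x_{i_2}\cdots x_{i_m}$. $\mathscr{A}$ is a $P_0$-tensor if for each $x\in\mathbb{R}^n\setminus\{0\}$ there is $i\in[n]$ with $x_i\ne 0$ and $x_i(\mathscr{A}x^{m-1})_i\ge 0$. $\mathscr{A}$ is a $P_0^\prime$-tensor if for each $x\in\mathbb{R}^n\setminus\{0\}$ there is $i\in[n]$ with $x_i\ne 0$ and $x_i^{m-1}(\mathscr{A}x^{m-1})_i\ge 0$. $\mathscr{A}$ is a $Q$-tensor ($\mathscr{A}\in Q$) if for every $q\in\mathbb{R}^n$ there is $x\in\mathbb{R}^n$ with $x\ge 0$, $\mathscr{A}x^{m-1}+q\ge 0$, $x^T(\mathscr{A}x^{m-1}+q)=0$. $\mathscr{A}$ is an $R$-tensor ($\mathscr{A}\in R$) if there is no $(x,t)\in(\mathbb{R}^n_+\setminus\{0\})\times\mathbb{R}_+$ such that for all $i\in[n]$: $(\mathscr{A}x^{m-1})_i+t=0$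 if $x_i>0$, and $(\mathscr{A}x^{m-1})_i+t\ge 0$ if $x_i=0$. $\mathscr{A}$ is an $R_0$-tensor ($\mathscr{A}\in R_0$) if this system has no solution $x\in\mathbb{R}^n_+\setminus\{0\}$ when $t=0$. *)

(* Defs.v *)
From mathcomp Require Import all_boot all_order all_algebra.
From mathcomp Require Import reals.

Set Implicit Arguments.
Unset Strict Implicit.
Unset Printing Implicit Defensive.

Import Order.TTheory GRing.Theory Num.Theory.
Local Open Scope ring_scope.

(* The index set [n] is 'I_n; the label i of [n] is the ordinal of value i - 1. *)
Definition tensor (R : realType) (m n : nat) := m.-tuple 'I_n -> R.

Section Tensor.
Variables (R : realType) (m n : nat).
Implicit Types (A : tensor R m n) (x q : 'cV[R]_n).

(* A x^{m-1}: coordinate i sums over the m-tuples (i, i_2, ..., i_m), the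
   product running over the last m - 1 indices. *)
Definition tapp A x : 'cV[R]_n :=
  \col_i \sum_(t : m.-tuple 'I_n | ohead t == Some i)
    A t * \prod_(j <- behead t) x j 0.

Definition nonneg x := forall i, 0 <= x i 0.

Definition P0_tensor A :=
  forall x, x != 0 -> exists i, x i 0 != 0 /\ 0 <= x i 0 * tapp A x i 0.

Definition P0'_tensor A :=
  forall x, x != 0 ->
    exists i, x i 0 != 0 /\ 0 <= x i 0 ^+ m.-1 * tapp A x i 0.

Definition Q_tensor A :=
  forall q, exists x,
    [/\ nonneg x, nonneg (tapp A x + q) & x^T *m (tapp A x + q) = 0].

Definition R_system A x (t : R) :=
  forall i, (0 < x i 0 -> tapp A x i 0 + t = 0) /\
            (x i 0 = 0 -> 0 <= tapp A x i 0 + t).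

Definition R_tensor A :=
  ~ exists x t, [/\ nonneg x, x != 0, 0 <= t & R_system A x t].

Definition R0_tensor A :=
  ~ exists x, [/\ nonneg x, x != 0 & R_system A x 0].

End Tensor.

(* The multi-index of t with its labels in 1, ..., n. *)
Definition labels (m n : nat) (t : m.-tuple 'I_n) : seq nat :=
  [seq (val j).+1 | j <- t].

Definition tensorA (R : realType) : tensor R 4 2 := fun t =>
  if labels t \in [:: [:: 1; 1; 2; 2]; [:: 2; 2; 2; 2]]%N then 1
  else if labels t == [:: 2; 1; 1; 2]%N then -1 else 0.

Definition tensorB (R : realType) : tensor R 3 2 := fun t =>
  if labels t \in [:: [:: 1; 2; 2]; [:: 2; 2; 2]]%N then 1
  else if labels t == [:: 2; 1; 2]%N then -1 else 0.

(* Main.v *)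
Require Import Defs.
From mathcomp Require Import all_boot all_order all_algebra.
From mathcomp Require Import reals.
From mathcomp Require Import ring lra.

Set Implicit Arguments.
Unset Strict Implicit.
Unset Printing Implicit Defensive.

Import Order.TTheory GRing.Theory Num.Theory.
Local Open Scope ring_scope.

(** In coordinates x = (a, b) the two maps are A x^3 = (a b^2, b^3 - a^2 b) and
    B x^2 = (b^2, b^2 - a b).  The first coordinate has the sign required by
    P_0 (resp. P_0') whenever a <> 0, the second one when a = 0.  The vector
    (1, 0) is a zero of both maps, so R_0 fails.  For the Q property the only
    delicate case is a negative first coordinate p of q = (p, r).  For A both
    equations must hold: a = - p / b^2, and u = b^3 is the positive root of
    u^2 + r u - p^2.  For B one takes b = sqrt (- p) and a = (r - p) / b if
    p <= r, and (0, sqrt (- r)) otherwise. *)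

(** Peels off one index at a time, so that a sum over tuples of fixed length expands into explicit
    terms. *)
Lemma big_tuple_cons (V : nmodType) (I : finType) (k : nat)
    (F : k.+1.-tuple I -> V) :
  \sum_(t : k.+1.-tuple I) F t =
  \sum_i \sum_(t : k.-tuple I) F [tuple of i :: t].
Proof.
rewrite pair_big /=.
rewrite (reindex (fun p : I * k.-tuple I => [tuple of p.1 :: p.2])) //=.
exists (fun t => (thead t, [tuple of behead t])) => [[i t] _|t _] /=.
  by congr pair; apply: val_inj.
by rewrite -tuple_eta.
Qed.

Lemma big_tuple0 (V : nmodType) (I : finType) (F : 0.-tuple I -> V) :
  \sum_(t : 0.-tuple I) F t = F [tuple].
Proof. by rewrite (big_pred1 [tuple]) // => t; apply/esym/eqP/val_inj; case: t => -[]. Qed.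

Section Examples.
Variable R : realType.
Implicit Types (x : 'cV[R]_2) (a b p r : R).

(** Among the possible heads of the multi-index only [i] survives the filter; the free indices form
    the tail. *)
Lemma tapp_cons (k n : nat) (A : tensor R k.+1 n) (y : 'cV[R]_n) (i : 'I_n) :
  tapp A y i 0 =
  \sum_(t : k.-tuple 'I_n) A [tuple of i :: t] * \prod_(j <- t) y j 0.
Proof.
rewrite mxE big_mkcond big_tuple_cons /= (bigD1 i) //=.
rewrite [X in _ + X]big1 ?addr0 => [|j nji].
  by apply: eq_bigr => t _; rewrite eqxx.
by rewrite big1 // => t _; rewrite (inj_eq Some_inj) (negPf nji).
Qed.

Lemma tapp_tensorA x :
  tapp (tensorA R) x 0 0 = x 0 0 * x 1 0 ^+ 2 /\
  tapp (tensorA R) x 1 0 = x 1 0 ^+ 3 - x 0 0 ^+ 2 * x 1 0.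
Proof.
have l1 : lift ord0 ord0 = 1 :> 'I_2 by apply: val_inj.
(* Each round expands one of the three free indices; the coefficients of the eight resulting terms
   then compute. *)
rewrite !tapp_cons !big_tuple_cons !big_ord_recl !big_ord0 !l1.
rewrite !big_tuple_cons !big_ord_recl !big_ord0 !l1.
rewrite !big_tuple_cons !big_ord_recl !big_ord0 !l1.
rewrite !big_tuple0 /tensorA /labels /= !big_cons !big_nil /=.
by split; ring.
Qed.

Lemma tapp_tensorB x :
  tapp (tensorB R) x 0 0 = x 1 0 ^+ 2 /\
  tapp (tensorB R) x 1 0 = x 1 0 ^+ 2 - x 0 0 * x 1 0.
Proof.
have l1 : lift ord0 ord0 = 1 :> 'I_2 by apply: val_inj.
rewrite !tapp_cons !big_tuple_cons !big_ord_recl !big_ord0 !l1.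
rewrite !big_tuple_cons !big_ord_recl !big_ord0 !l1.
rewrite !big_tuple0 /tensorB /labels /= !big_cons !big_nil /=.
by split; ring.
Qed.

Lemma forall_ord2 (P : 'I_2 -> Prop) : P 0 -> P 1 -> forall i, P i.
Proof.
move=> P0 P1 [[|[|//]] lti].
- by rewrite (_ : Ordinal lti = 0) //; apply: val_inj.
- by rewrite (_ : Ordinal lti = 1) //; apply: val_inj.
Qed.

Definition col2 a b : 'cV[R]_2 := \col_i if i == 0 then a else b.

Lemma col2_0 a b : col2 a b 0 0 = a. Proof. by rewrite mxE. Qed.

Lemma col2_1 a b : col2 a b 1 0 = b. Proof. by rewrite mxE. Qed.

Lemma col2_neq0 x : x != 0 -> x 0 0 = 0 -> x 1 0 != 0.
Proof.
move=> xn0 x0; apply: contra_neq xn0 => x1.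
by apply/colP; apply: forall_ord2; rewrite mxE.
Qed.

(** The complementarity product is a sum of two terms, and it suffices to make each of them
    vanish. *)
Lemma Q_tensor2 (k : nat) (A : tensor R k 2) :
  (forall p r, exists a b,
     [/\ 0 <= a /\ 0 <= b,
         0 <= tapp A (col2 a b) 0 0 + p /\ a * (tapp A (col2 a b) 0 0 + p) = 0 &
         0 <= tapp A (col2 a b) 1 0 + r /\
         b * (tapp A (col2 a b) 1 0 + r) = 0]) ->
  Q_tensor A.
Proof.
move=> AQ q; have [a [b [[a0 b0] [p0 ap] [r0 br]]]] := AQ (q 0 0) (q 1 0).
exists (col2 a b); split.
- by apply: forall_ord2; rewrite ?col2_0 ?col2_1.
- by apply: forall_ord2; rewrite [(_ + q) _ _]mxE.
apply/matrixP => i j; rewrite !ord1 {i j}.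
have l1 : lift ord0 ord0 = 1 :> 'I_2 by apply: val_inj.
rewrite [LHS]mxE !big_ord_recl big_ord0 l1 addr0.
rewrite ![(col2 a b)^T _ _]mxE col2_0 col2_1 ![(tapp A _ + q) _ _]mxE.
by move: ap br; rewrite ![tapp A _ _ _]mxE => -> ->; rewrite addr0 mxE.
Qed.

Lemma not_R0_tensor2 (k : nat) (A : tensor R k 2) :
  tapp A (col2 1 0) 0 0 = 0 -> tapp A (col2 1 0) 1 0 = 0 -> ~ R0_tensor A.
Proof.
move=> A0 A1; apply; exists (col2 1 0); split.
- by apply: forall_ord2; rewrite ?col2_0 ?col2_1.
- by apply/eqP => /colP/(_ 0)/eqP; rewrite col2_0 mxE oner_eq0.
- by apply: forall_ord2; rewrite ?A0 ?A1 addr0.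
Qed.

Lemma cube_root p : 0 <= p -> exists2 b, 0 <= b & b ^+ 3 = p.
Proof.
(* The endpoint [p + 1] serves small and large [p] alike, since [(p + 1) ^+ 3 >= p]. *)
move=> p0; have [||b /andP[b0 _]] := @poly_ivt R ('X^3 - p%:P) 0 (p + 1).
- by lra.
- by rewrite !hornerE; apply/andP; split; nra.
by rewrite /root !hornerE subr_eq0 => /eqP <-; exists b.
Qed.

Lemma tensorA_P0 : P0_tensor (tensorA R).
Proof.
move=> x xn0; have [A0 A1] := tapp_tensorA x.
(* The products to be bounded are the square of [x 0 0 * x 1 0], and the fourth power of [x 1 0]
   when [x 0 0 = 0]. *)
have [x0|x0] := eqVneq (x 0 0) 0; last by exists 0; rewrite A0; split => //; nra.
by exists 1; rewrite A1 x0; split; [exact: col2_neq0 | nra].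
Qed.

Lemma tensorA_Q : Q_tensor (tensorA R).
Proof.
apply: Q_tensor2 => p r; have [p0|p0] := leP 0 p.
  have [r0|r0] := leP 0 r.
    exists 0, 0; have [-> ->] := tapp_tensorA (col2 0 0).
    by rewrite col2_0 col2_1; split; split; lra.
  have [b b0 b3] : exists2 b, 0 <= b & b ^+ 3 = - r by apply: cube_root; lra.
  exists 0, b; have [-> ->] := tapp_tensorA (col2 0 b).
  by rewrite col2_0 col2_1 b3; split; split; lra.
(* Here [s] is the square root of the discriminant of [u^2 + r u - p^2], with positive root
   [(s - r) / 2]; [p < 0] makes [s > r]. *)
pose s := Num.sqrt (r ^+ 2 + 4 * p ^+ 2).
have s0 : 0 <= s by apply: sqrtr_ge0.
have s2 : s ^+ 2 = r ^+ 2 + 4 * p ^+ 2 by rewrite sqr_sqrtr //; nra.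
have rs : r < s by nra.
have [b b0 b3] : exists2 b, 0 <= b & b ^+ 3 = (s - r) / 2.
  by apply: cube_root; lra.
have bn0 : b != 0 by apply/eqP => bz; move: b3; rewrite bz expr0n /=; lra.
have eq0 : - p / b ^+ 2 * b ^+ 2 + p = 0 by field.
have eq1 : b ^+ 3 - (- p / b ^+ 2) ^+ 2 * b + r = 0.
  (* Over the denominator [b ^+ 3], the numerator is the quadratic evaluated at [u = b ^+ 3]. *)
  have -> : b ^+ 3 - (- p / b ^+ 2) ^+ 2 * b + r =
            ((b ^+ 3) ^+ 2 + r * b ^+ 3 - p ^+ 2) / b ^+ 3 by field.
  rewrite [X in X / _](_ : _ = 0) ?mul0r // b3.
  have -> : p ^+ 2 = (s ^+ 2 - r ^+ 2) / 4 by rewrite s2; field.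
  by field.
exists (- p / b ^+ 2), b; have [-> ->] := tapp_tensorA (col2 (- p / b ^+ 2) b).
rewrite col2_0 col2_1 eq0 eq1 !mulr0; split; split=> //.
by rewrite divr_ge0 ?exprn_ge0 // oppr_ge0 ltW.
Qed.

Lemma tensorA_not_R0 : ~ R0_tensor (tensorA R).
Proof.
by apply: not_R0_tensor2; have [A0 A1] := tapp_tensorA (col2 1 0);
  rewrite ?A0 ?A1 col2_0 col2_1; ring.
Qed.

Lemma tensorB_P0' : P0'_tensor (tensorB R).
Proof.
move=> x xn0; have [B0 B1] := tapp_tensorB x.
have [x0|x0] := eqVneq (x 0 0) 0; last by exists 0; rewrite B0; split => //; nra.
by exists 1; rewrite B1 x0; split; [exact: col2_neq0 | nra].
Qed.

Lemma tensorB_Q : Q_tensor (tensorB R).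
Proof.
(* For [r] below both [p] and 0, the choice [a = 0], [b ^+ 2 = - r] leaves the first slack [p - r]
   positive. *)
apply: Q_tensor2 => p r; have [rp|rp] := ltP r (Num.min p 0).
  have [rp0 r0] : r < p /\ r < 0 by apply/andP; rewrite -lt_min.
  have b2 : Num.sqrt (- r) ^+ 2 = - r by rewrite sqr_sqrtr //; lra.
  exists 0, (Num.sqrt (- r)).
  have [-> ->] := tapp_tensorB (col2 0 (Num.sqrt (- r))).
  rewrite col2_0 col2_1 b2 !mul0r subr0 addNr mulr0 sqrtr_ge0.
  by split; split=> //; lra.
have [p0|p0] := leP 0 p.
  exists 0, 0; have [-> ->] := tapp_tensorB (col2 0 0).
  move: rp; rewrite (min_idPr p0) col2_0 col2_1 => rp.
  by split; split; lra.
have pr : p <= r by move: rp; rewrite (min_idPl (ltW p0)).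
pose b := Num.sqrt (- p).
have b2 : b ^+ 2 = - p by rewrite sqr_sqrtr //; lra.
have b0 : 0 < b by rewrite sqrtr_gt0; lra.
have bn0 : b != 0 by rewrite gt_eqF.
(* With [b ^+ 2 = - p] the first slack is 0; this [a] solves [b^2 - a b + r = 0], and [p <= r] makes
   it nonnegative. *)
exists ((r - p) / b), b; have [-> ->] := tapp_tensorB (col2 ((r - p) / b) b).
rewrite col2_0 col2_1 divfK // b2 addNr.
have -> : - p - (r - p) + r = 0 by ring.
rewrite !mulr0; split; split=> //; last exact: ltW.
by rewrite divr_ge0 ?subr_ge0 // ltW.
Qed.

Lemma tensorB_not_R0 : ~ R0_tensor (tensorB R).
Proof.
by apply: not_R0_tensor2; have [B0 B1] := tapp_tensorB (col2 1 0);
  rewrite ?B0 ?B1 ?col2_0 col2_1; ring.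
Qed.

End Examples.

Theorem mainTheorem7 (R : realType) :
  [/\ P0_tensor (tensorA R), Q_tensor (tensorA R) & ~ R0_tensor (tensorA R)] /\
  [/\ P0'_tensor (tensorB R), Q_tensor (tensorB R) & ~ R0_tensor (tensorB R)] /\
  ~ (forall m n : nat, (3 <= m)%N -> (2 <= n)%N ->
       forall A : tensor R m n, P0_tensor A ->
         (R0_tensor A <-> R_tensor A) /\ (R_tensor A <-> Q_tensor A)) /\
  ~ (forall m n : nat, (3 <= m)%N -> (2 <= n)%N ->
       forall A : tensor R m n, P0'_tensor A ->
         (R0_tensor A <-> R_tensor A) /\ (R_tensor A <-> Q_tensor A)).
Proof.
have [AP AQ AR0] := And3 (@tensorA_P0 R) (@tensorA_Q R) (@tensorA_not_R0 R).
have [BP BQ BR0] := And3 (@tensorB_P0' R) (@tensorB_Q R) (@tensorB_not_R0 R).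
do 3![split=> //] => H.
(* The claimed equivalences would carry Q back through R to R_0, which fails. *)
- by have [R0R RQ] := H 4 2 isT isT _ AP; apply/AR0/R0R/RQ.
- by have [R0R RQ] := H 3 2 isT isT _ BP; apply/BR0/R0R/RQ.
Qed.
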